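(* Let $n\ge 2$ and let $k_1,\dots,k_n\ge 3$ be integers. Let $\mathcal{H}_{\{k_1-1,\dots,k_n-1\}}$ be the hinge graph obtained by gluing cycles $C_1,\dots,C_n$ with $k_1,\dots,k_n$ vertices along one common edge $xy$. Fix $i$, and let $\epsilon_{x,y}$ be the divisor that assigns $1$ and $-1$ to a shared vertex and to a non-shared vertex of $C_i$ adjacent to it (in either order), and $0$ elsewhere. Let $\delta_{x,y}$ be the divisor assigning $1$ to one shared vertex, $-1$ to the other, and $0$ elsewhere. Suppose that either there are at least two base cycles with $k_i$ vertices, or there exists another base cycle $C_j$ ($j\ne i$) with $t(k_i-1)+1$ vertices for some positive integer $t$. Then the order of $\epsilon_{x,y}$ in the critical group is $(k_i-1)|\delta_{x,y}|$, where $|\delta_{x,y}|$ denotes the order of $\delta_{x,y}$.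
   Context: The hinge graph $\mathcal{H}_{\{k_1-1,\dots,k_n-1\}}$ is the simple graph with two distinguished (''shared'') vertices $x,y$ joined by an edge $xy$, together with $n$ internally vertex-disjoint paths from $x$ to $y$, the $i$-th path having $k_i-2$ internal vertices; the $i$-th path together with $xy$ is the cycle $C_i$ (base shape) with $k_i$ vertices. A divisor is a formal $\mathbb{Z}$-linear combination of vertices; two divisors are linearly equivalent if their difference lies in the image of the graph Laplacian (equivalently, one is obtained from the other by chip-firing moves). The order of a degree-zero divisor $D$ is the smallest positive integer $z$ such that $zD$ is linearly equivalent to the zero divisor. *)

(* Defs.v *)
From HB Require Import structures.
From mathcomp Require Import all_boot all_order all_algebra.

Set Implicit Arguments.
Unset Strict Implicit.
Unset Printing Implicit Defensive.

Import GRing.Theory.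
Local Open Scope ring_scope.

Notation divisor V := {ffun V -> int}.

Definition vdeg (V : finType) (e : rel V) (v : V) : nat := #|[set u | e v u]|.

Definition laplacian (V : finType) (e : rel V) (f : divisor V) : divisor V :=
  [ffun v => (vdeg e v)%:Z * f v - \sum_(u | e v u) f u].

Definition lin_equiv (V : finType) (e : rel V) (D1 D2 : divisor V) : Prop :=
  exists f : divisor V, D1 - D2 = laplacian e f.

(* [z] is the order of the class of [D]. Such a [z] is unique if it exists;
   for a connected graph it exists exactly when [D] has degree zero. *)
Definition is_order (V : finType) (e : rel V) (D : divisor V) (z : nat) : Prop :=
  [/\ (0 < z)%N, lin_equiv e (D *+ z) 0 &
      forall m : nat, (0 < m)%N -> lin_equiv e (D *+ m) 0 -> (z <= m)%N].

Definition pair_divisor (V : finType) (u v : V) : divisor V :=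
  [ffun w => (w == u)%:Z - (w == v)%:Z].

(* [inl false] is x, [inl true] is y, and [inr (Tagged _ j)] with tag [i] is the
   (j+1)-st internal vertex, counted from x, of the i-th path. *)
Definition hinge_vertex (n : nat) (k : 'I_n -> nat) : finType :=
  (bool + {i : 'I_n & 'I_(k i - 2)})%type.

Definition shared (n : nat) (k : 'I_n -> nat) (b : bool) : hinge_vertex k :=
  inl b.

Definition internal (n : nat) (k : 'I_n -> nat) (i : 'I_n) (j : 'I_(k i - 2)) :
  hinge_vertex k := inr (Tagged (fun i => 'I_(k i - 2)) j).

(* Whether an internal vertex is the one next to x (b = false) or y (b = true)
   on its path; both hold when the path has a single internal vertex. *)
Definition next_to_shared (n : nat) (k : 'I_n -> nat) (b : bool)
    (w : {i : 'I_n & 'I_(k i - 2)}) : bool :=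
  if b then (tagged w).+1 == (k (tag w) - 2)%N else tagged w == 0%N :> nat.

Definition hinge_adj (n : nat) (k : 'I_n -> nat) : rel (hinge_vertex k) :=
  fun u v =>
  match u, v with
  | inl a, inl b => a != b
  | inl a, inr w => next_to_shared a w
  | inr w, inl a => next_to_shared a w
  | inr w, inr w' => (tag w == tag w') &&
      (((tagged w).+1 == tagged w' :> nat) || ((tagged w').+1 == tagged w :> nat))
  end.

Lemma hinge_adj_sym (n : nat) (k : 'I_n -> nat) : symmetric (@hinge_adj n k).
Proof.
by move=> [a|w] [b|w'] //=; rewrite eq_sym // orbC.
Qed.

Lemma hinge_adj_irrefl (n : nat) (k : 'I_n -> nat) :
  irreflexive (@hinge_adj n k).
Proof.
by move=> [a|w] /=; rewrite eqxx //= orbb -[X in _ == X]addn0 -addn1 eqn_add2l.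
Qed.

(* Main.v *)
(** The class of a unit step along an internal path is constant, because every
    internal vertex has degree two; hence a path with [L] edges turns [L] times
    the class of epsilon into that of (plus or minus) delta.  It remains to see
    that [L] divides every [z] for which [z] epsilon is principal, say the
    Laplacian of [f].  Abel summation along the path of C_i, on which the
    Laplacian of [f] vanishes except at one end vertex, gives [L | z] as soon as
    [L | f x - f y]; and Abel summation along the other path, whose length is a
    multiple of [L], gives [L | f x - f y].  Delta has finite order because the
    Laplacian of the indicator of x is a sum of delta and of unit steps, all of
    which become multiples of delta after multiplication by the product of the
    path lengths. *)
Require Import Defs.
From HB Require Import structures.
From mathcomp Require Import all_boot all_order all_algebra.
From mathcomp Require Import zify ring.
From Stdlib Require Import Classical.

Set Implicit Arguments.
Unset Strict Implicit.
Unset Printing Implicit Defensive.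

Import GRing.Theory.
Local Open Scope ring_scope.

(** * Linear equivalence and orders of divisor classes for an arbitrary finite relation *)

Section LinearEquivalence.
Variables (V : finType) (e : rel V).
Implicit Types (D E : divisor V) (f : divisor V) (u v w : V).

Lemma laplacianE f v : laplacian e f v = \sum_(u | e v u) (f v - f u).
Proof.
rewrite ffunE sumrB sumr_const -mulr_natl /vdeg cardsE; congr (_ * _ - _).
by rewrite natz.
Qed.

Lemma laplacianD f g : laplacian e (f + g) = laplacian e f + laplacian e g.
Proof.
apply/ffunP => v; rewrite [RHS]ffunE !laplacianE -big_split /=.
by apply: eq_bigr => u _; rewrite !ffunE; ring.
Qed.

Lemma laplacianN f : laplacian e (- f) = - laplacian e f.
Proof.
apply/ffunP => v; rewrite [RHS]ffunE !laplacianE -sumrN.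
by apply: eq_bigr => u _; rewrite !ffunE; ring.
Qed.

Lemma lin_equiv_refl D : lin_equiv e D D.
Proof.
exists 0; apply/ffunP => v; rewrite subrr laplacianE big1 ?ffunE // => u _.
by rewrite !ffunE subrr.
Qed.

Lemma lin_equiv_sym {D E} : lin_equiv e D E -> lin_equiv e E D.
Proof. by case=> f Df; exists (- f); rewrite laplacianN -Df opprB. Qed.

Lemma lin_equivD {D E D' E'} :
  lin_equiv e D E -> lin_equiv e D' E' -> lin_equiv e (D + D') (E + E').
Proof.
by case=> f Df [g Dg]; exists (f + g); rewrite laplacianD -Df -Dg opprD addrACA.
Qed.

Lemma lin_equivN {D E} : lin_equiv e D E -> lin_equiv e (- D) (- E).
Proof.
by case=> f Df; exists (- f); rewrite laplacianN -Df opprB opprK addrC.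
Qed.

Lemma lin_equiv_trans {D E F} :
  lin_equiv e D E -> lin_equiv e E F -> lin_equiv e D F.
Proof.
by case=> f Df [g Dg]; exists (f + g); rewrite laplacianD -Df -Dg addrA subrK.
Qed.

Lemma lin_equiv_sum (I : finType) (P : pred I) (D E : I -> divisor V) :
  (forall l, P l -> lin_equiv e (D l) (E l)) ->
  lin_equiv e (\sum_(l | P l) D l) (\sum_(l | P l) E l).
Proof.
move=> DE; elim/big_ind2: _ => //; first exact: lin_equiv_refl.
by move=> ? ? ? ?; apply: lin_equivD.
Qed.

Lemma lin_equivMn {D E} m : lin_equiv e D E -> lin_equiv e (D *+ m) (E *+ m).
Proof.
by move=> DE; rewrite -(card_ord m) -!sumr_const; apply: lin_equiv_sum.
Qed.

Lemma lin_equiv0Mn {D} m : lin_equiv e D 0 -> lin_equiv e (D *+ m) 0.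
Proof. by move/(lin_equivMn m); rewrite mul0rn. Qed.

Lemma is_orderN D z : is_order e D z -> is_order e (- D) z.
Proof.
have N0 E : lin_equiv e E 0 -> lin_equiv e (- E) 0.
  by move/lin_equivN; rewrite oppr0.
case=> z_gt0 zD z_min; split=> //; first by rewrite mulNrn; apply: N0.
by move=> m m_gt0 /N0; rewrite mulNrn opprK; apply: z_min.
Qed.

Lemma is_order_exists D m :
  (0 < m)%N -> lin_equiv e (D *+ m) 0 -> exists d, is_order e D d.
Proof.
elim/ltn_ind: m => m IH m_gt0 mD.
(* Linear equivalence is a mere proposition here, so the descent to the least exponent uses excluded
   middle. *)
case: (classic (exists2 z, (z < m)%N & (0 < z)%N /\ lin_equiv e (D *+ z) 0)).
  by case=> z ltzm [z_gt0 zD]; apply: (IH z).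
move=> noz; exists m; split=> // z z_gt0 zD.
by rewrite leqNgt; apply/negP => ltzm; apply: noz; exists z.
Qed.

(** Any [z] killing [D] has the form [q * m], and then [q] kills [E], so [d <= q]. *)
Lemma is_order_muln D E m d :
    (0 < m)%N -> lin_equiv e (D *+ m) E ->
    (forall z, lin_equiv e (D *+ z) 0 -> (m %| z)%N) ->
  is_order e E d -> is_order e D (m * d).
Proof.
move=> m_gt0 mDE dvd_m [d_gt0 dE d_min].
have mDzE z : lin_equiv e (D *+ (m * z)) (E *+ z).
  by rewrite mulrnA; apply: lin_equivMn.
split=> [||z z_gt0 zD]; first by rewrite muln_gt0 m_gt0.
  exact: lin_equiv_trans (mDzE d) dE.
have /dvdnP[q Dz] := dvd_m _ zD; move: z_gt0 zD; rewrite {}Dz mulnC muln_gt0.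
case/andP=> _ q_gt0 zD; rewrite leq_pmul2l // d_min //.
exact: lin_equiv_trans (lin_equiv_sym (mDzE q)) zD.
Qed.

Lemma pair_divisorN u v : - pair_divisor u v = pair_divisor v u.
Proof. by apply/ffunP => w; rewrite !ffunE opprB. Qed.

Lemma pair_divisorD u v w :
  pair_divisor u v + pair_divisor v w = pair_divisor u w.
Proof. by apply/ffunP => t; rewrite !ffunE addrA subrK. Qed.

Lemma pair_divisor_telescope (p : nat -> V) m :
  \sum_(s < m) pair_divisor (p s) (p s.+1) = pair_divisor (p 0%N) (p m).
Proof.
elim: m => [|m IH]; last by rewrite big_ord_recr /= IH pair_divisorD.
by rewrite big_ord0; apply/ffunP => t; rewrite !ffunE subrr.
Qed.

(** The sum is the Laplacian of the indicator of [v]. These are the only relations from which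
    equivalences are built below. *)
Lemma sum_neighbour_pairs v :
  symmetric e -> lin_equiv e (\sum_(u | e v u) pair_divisor v u) 0.
Proof.
move=> e_sym; exists [ffun w => (w == v)%:Z]; rewrite subr0.
apply/ffunP => w; rewrite laplacianE sum_ffunE.
under eq_bigr do rewrite !ffunE.
under [RHS]eq_bigr do rewrite !ffunE.
have [->|neq_wv] := eqVneq w v.
  by apply: eq_bigr => u _; rewrite eq_sym.
under eq_bigr do rewrite sub0r.
under [RHS]eq_bigr do rewrite sub0r.
(* Away from [v] both sides are minus an adjacency indicator, [e w v] on one side and [e v w] on the
   other. *)
rewrite !sumrN; congr (- _).
have pick1 x y : \sum_(u | e x u) (y == u)%:Z = (e x y)%:Z.
  rewrite big_mkcond (bigD1 y) //= eqxx big1 ?addr0; first by case: (e x y).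
  by move=> u; rewrite eq_sym => /negbTE->; case: ifP.
by under [RHS]eq_bigr do rewrite eq_sym; rewrite !pick1 e_sym.
Qed.

End LinearEquivalence.

(** With [g] read along a path, the bracket is the Laplacian at position [s.+1], weighted by its
    distance to the start. *)
Lemma abel_summation (g : nat -> int) m :
  \sum_(s < m) s.+1%:Z * ((g s.+1 - g s) + (g s.+1 - g s.+2)) =
  m.+1%:Z * (g m - g m.+1) - (g 0%N - g m.+1).
Proof.
elim: m => [|m IH]; first by rewrite big_ord0; ring.
rewrite big_ord_recr /= IH (_ : m.+2%:Z = m.+1%:Z + 1); first by ring.
by rewrite -PoszD addn1.
Qed.

(** * Vertices and neighbours along the paths of the hinge graph *)

Section HingePaths.
Variables (n : nat) (k : 'I_n -> nat).
Hypothesis hk : forall l, (3 <= k l)%N.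
Local Notation V := (hinge_vertex k).
Local Notation adj := (@hinge_adj n k).

(* The vertex at distance [s] from x along the [l]-th path; it is y for
   [s >= k l - 1]. *)
Definition path_vertex (l : 'I_n) (s : nat) : V :=
  if s is s'.+1 then
    if insub s' is Some j then @internal n k l j else shared k true
  else shared k false.

Lemma path_vertex_internal (l : 'I_n) (j : 'I_(k l - 2)) :
  path_vertex l j.+1 = internal j.
Proof. by rewrite /= valK. Qed.

Lemma path_vertex_end l : path_vertex l (k l - 1) = shared k true.
Proof.
have -> : (k l - 1)%N = (k l - 2).+1 by have := hk l; lia.
by rewrite /= insubN // ltnn.
Qed.

Lemma eq_path_vertex_false l s :
  (shared k false == path_vertex l s) = (s == 0%N).
Proof. by case: s => [|s] //=; case: insubP. Qed.

Lemma eq_path_vertex_true l s :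
  (shared k true == path_vertex l s) = (k l - 2 < s)%N.
Proof.
case: s => [|s] //=; rewrite ltnS leqNgt.
by case: insubP => [j ->|/negbTE->].
Qed.

Lemma eq_path_vertex_internal l (l' : 'I_n) (j : 'I_(k l' - 2)) s :
  (internal j == path_vertex l s) = (l' == l) && (j.+1 == s).
Proof.
case: s => [|s]; first by rewrite andbF.
rewrite eqSS /=; case: insubP => [j' _ <-|ltsk].
  pose T l := 'I_(k l - 2); rewrite -[LHS]/(Tagged T j == Tagged T j').
  have [eql|neql] := eqVneq l' l; first by subst l'; rewrite eq_Tagged.
  by apply: contra_neqF neql => /eqP/(congr1 tag).
symmetry; apply/negbTE/andP => -[/eqP eql /eqP Ds]; subst l' s.
by rewrite ltn_ord in ltsk.
Qed.

Lemma adj_internal l (j : 'I_(k l - 2)) u :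
  adj (internal j) u = (u == path_vertex l j) || (u == path_vertex l j.+2).
Proof.
have ltj := ltn_ord j.
case: u => [[]|[l' j']].
- rewrite !(eq_path_vertex_true l) /= /next_to_shared /=; lia.
- by rewrite !(eq_path_vertex_false l) /= /next_to_shared /= orbF.
rewrite !(eq_path_vertex_internal l j') /= (eq_sym l l') -andb_orr.
by congr (_ && _); lia.
Qed.

Lemma sum_adj_internal (W : nmodType) l (j : 'I_(k l - 2)) (F : V -> W) :
  \sum_(u | adj (internal j) u) F u =
  F (path_vertex l j) + F (path_vertex l j.+2).
Proof.
(* The neighbour nearer x is x itself or an internal vertex, and both kinds occur at a single
   position only. *)
have neq : path_vertex l j.+2 != path_vertex l j.
  case: j => -[|j] ltj; first by rewrite eq_sym (eq_path_vertex_false l 2).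
  rewrite eq_sym (path_vertex_internal (Ordinal (ltnW ltj))).
  by rewrite eq_path_vertex_internal eqxx /=; lia.
rewrite (bigD1 (path_vertex l j)) ?adj_internal ?eqxx //; congr (_ + _).
rewrite (big_pred1 (path_vertex l j.+2)) // => u; rewrite adj_internal.
have [->|] := eqVneq u (path_vertex l j); last by rewrite andbT.
by rewrite andbF -[RHS]/(_ == _) eq_sym (negbTE neq).
Qed.

(** * Unit steps, and the multiples of epsilon and delta that vanish *)

Definition path_step l s : divisor V :=
  pair_divisor (path_vertex l s) (path_vertex l s.+1).

(** The relation at the internal vertex in position [s.+1] is the difference of the steps on its two
    sides. *)
Lemma path_step_equiv l s :
  (s < k l - 1)%N -> lin_equiv adj (path_step l s) (path_step l 0).
Proof.
elim: s => [|s IH] lts; first exact: lin_equiv_refl.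
apply: lin_equiv_trans (IH (ltnW lts)).
have lts2 : (s < k l - 2)%N by lia.
have := sum_neighbour_pairs (internal (Ordinal lts2)) (@hinge_adj_sym n k).
rewrite sum_adj_internal -path_vertex_internal -pair_divisorN addrC => H.
have := lin_equivD H (lin_equiv_refl adj (path_step l s)).
by rewrite subrK add0r.
Qed.

Lemma path_step_muln l s : (s < k l - 1)%N ->
  lin_equiv adj (path_step l s *+ (k l - 1))
    (pair_divisor (shared k false) (shared k true)).
Proof.
move=> lts; rewrite -(path_vertex_end l) -[shared k false]/(path_vertex l 0).
rewrite -pair_divisor_telescope -[X in _ *+ X]card_ord -sumr_const.
apply: lin_equiv_sum => s' _.
apply: lin_equiv_trans (path_step_equiv lts) (lin_equiv_sym _).
exact: path_step_equiv.
Qed.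

Lemma laplacian_path (f : divisor V) l :
  \sum_(j < k l - 2) j.+1%:Z * laplacian adj f (internal j) =
  (k l - 1)%:Z * (f (path_vertex l (k l - 2)) - f (shared k true))
  - (f (shared k false) - f (shared k true)).
Proof.
have Dk : (k l - 1)%N = (k l - 2).+1 by have := hk l; lia.
rewrite -(path_vertex_end l) -[shared k false]/(path_vertex l 0) Dk.
rewrite -(abel_summation (fun s => f (path_vertex l s))); apply: eq_bigr => j _.
by rewrite laplacianE sum_adj_internal path_vertex_internal.
Qed.

Lemma shared_pair_torsion : exists2 m, (0 < m)%N &
  lin_equiv adj (pair_divisor (shared k false) (shared k true) *+ m) 0.
Proof.
set x := shared k false; set y := shared k true.
pose P := (\prod_l (k l - 1))%N.
have P_gt0 : (0 < P)%N by rewrite prodn_gt0 // => l; have := hk l; lia.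
(* For a neighbour [u] of x, [P] times the pair of x and [u] is equivalent to [c u] times delta. The
   edge xy alone contributes [P], so the total is positive. *)
pose c (u : V) := if u is inr w then (P %/ (k (tag w) - 1))%N else P.
exists (\sum_(u | adj x u) c u)%N.
  by rewrite (bigD1 y) //= addn_gt0 P_gt0.
have := lin_equiv0Mn P (sum_neighbour_pairs x (@hinge_adj_sym n k)).
apply: lin_equiv_trans; rewrite -sumrMnl -sumrMnr; apply: lin_equiv_sum.
case=> [[] _|[l j]] //=; first exact: lin_equiv_refl.
rewrite /next_to_shared /= => /eqP j0.
have dvdP : (k l - 1 %| P)%N by rewrite /P (bigD1 l) //= dvdn_mulr.
have -> : inr (existT _ l j) = path_vertex l 1.
  by rewrite -[LHS]path_vertex_internal j0.
rewrite -{2}(divnK dvdP) mulnC mulrnA; apply/lin_equivMn/lin_equiv_sym.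
by apply: (@path_step_muln l 0); have := hk l; lia.
Qed.

Lemma internal_pair_muln l a (j : 'I_(k l - 2)) :
    adj (shared k a) (internal j) ->
  lin_equiv adj (pair_divisor (shared k a) (internal j) *+ (k l - 1))
    (pair_divisor (shared k a) (shared k (~~ a))).
Proof.
have Dk : (k l - 1 = (k l - 2).+1)%N by have := hk l; lia.
case: a; rewrite /= /next_to_shared /= => /eqP Dj; last first.
  by rewrite -path_vertex_internal Dj; apply: (@path_step_muln l 0); rewrite Dk.
(* At y the pair is the negative of the last step of the path, so both sides are negated. *)
rewrite -[X in lin_equiv _ X _]opprK -[X in lin_equiv _ _ X]pair_divisorN.
apply: lin_equivN; rewrite -mulNrn pair_divisorN -path_vertex_internal Dj.
have := @path_step_muln l (k l - 2); rewrite /path_step -Dk path_vertex_end.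
by apply; rewrite Dk.
Qed.

Lemma internal_pair_dvdn i l a (j : 'I_(k i - 2)) z :
    adj (shared k a) (internal j) -> l != i -> (k i - 1 %| k l - 1)%N ->
    lin_equiv adj (pair_divisor (shared k a) (internal j) *+ z) 0 ->
  (k i - 1 %| z)%N.
Proof.
move=> adj_aj neq_li dvd_kl [f]; rewrite subr0 => Df.
have D_int l' (j' : 'I_(k l' - 2)) :
    laplacian adj f (internal j') = - ((internal j' == internal j)%:Z *+ z).
  by rewrite -Df ffunMnE ffunE sub0r mulNrn.
(* Epsilon vanishes inside the [l]-th path, so [f x - f y] is a multiple of [k l - 1], hence of
   [k i - 1]. *)
have := laplacian_path f l; rewrite big1 => [/esym/eqP|j' _]; last first.
  rewrite D_int -path_vertex_internal eq_sym eq_path_vertex_internal.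
  by rewrite eq_sym (negbTE neq_li) mul0rn oppr0 mulr0.
rewrite subr_eq0 => /eqP Dh.
have := laplacian_path f i.
(* On the [i]-th path only [j] contributes, namely [- z] with weight [j.+1]. *)
rewrite (bigD1 j) //= big1 => [|j' neq_j]; last first.
  rewrite D_int -path_vertex_internal eq_sym eq_path_vertex_internal eqxx.
  by rewrite eqSS (inj_eq val_inj) eq_sym (negbTE neq_j) mul0rn oppr0 mulr0.
rewrite addr0 D_int eqxx -Dh => Dz.
have {Dz} dvd_jz : (k i - 1 %| j.+1 * z)%N.
  have [t Dt] := dvdnP dvd_kl; move: Dz; rewrite Dt PoszM.
  set A := f _ - _; set B := f _ - _ => Dz.
  suff: ((k i - 1)%:Z %| (j.+1 * z)%N%:Z)%Z by [].
  apply/dvdzP; exists (t%:Z * A - B).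
  by rewrite PoszM -[LHS]opprK -mulrN -[z%:Z]natz Dz; ring.
(* The weight [j.+1] is 1 next to x and [k i - 2] next to y, in both cases coprime to [k i - 1]. *)
move: dvd_jz; rewrite Gauss_dvdr //.
have k_ge3 := hk i; move: adj_aj.
case: (a); rewrite /= /next_to_shared /= => /eqP Dj.
  by rewrite (_ : k i - 1 = j.+2)%N ?coprimeSn //; lia.
by rewrite Dj coprimen1.
Qed.

End HingePaths.

Theorem theorem4p4 (n : nat) (k : 'I_n -> nat)
    (hn : (2 <= n)%N) (hk : forall l : 'I_n, (3 <= k l)%N)
    (i : 'I_n)
    (a : bool) (j : 'I_(k i - 2))
    (hadj : hinge_adj (shared k a) (internal j))
    (epsilon : divisor (hinge_vertex k))
    (heps : epsilon = pair_divisor (shared k a) (internal j) \/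
            epsilon = pair_divisor (internal j) (shared k a))
    (b c : bool) (hbc : b != c)
    (delta : divisor (hinge_vertex k))
    (hdelta : delta = pair_divisor (shared k b) (shared k c))
    (hcycles : (2 <= #|[set l : 'I_n | k l == k i]|)%N \/
               (exists l : 'I_n, l != i /\
                  exists t : nat, (0 < t)%N /\ k l = (t * (k i - 1) + 1)%N)) :
  exists d : nat, is_order (@hinge_adj n k) delta d /\
                  is_order (@hinge_adj n k) epsilon ((k i - 1) * d)%N.
Proof.
(* Both alternatives of [hcycles] are used only through this divisibility of path lengths. *)
have [l neq_li dvd_kl] : exists2 l, l != i & (k i - 1 %| k l - 1)%N.
  case: hcycles => [|[l [neq_li [t [_ Dk]]]]].
    rewrite (cardsD1 i) inE eqxx => /card_gt0P[l].
    by rewrite !inE => /andP[neq_li /eqP Dk]; exists l; rewrite ?Dk.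
  by exists l; rewrite // Dk addnK dvdn_mull.
have [m m_gt0 m_tors] := shared_pair_torsion hk.
have [d ord_xy] := is_order_exists m_gt0 m_tors.
have ord_shared b1 b2 : b1 != b2 ->
    is_order (@hinge_adj n k) (pair_divisor (shared k b1) (shared k b2)) d.
  by case: b1 b2 => [] [] // _; rewrite -pair_divisorN; apply: is_orderN.
exists d; split; first by rewrite hdelta; apply: ord_shared.
have ord_eps : is_order (@hinge_adj n k)
    (pair_divisor (shared k a) (internal j)) ((k i - 1) * d).
  apply: is_order_muln (internal_pair_muln hk hadj) _ _.
  - by have := hk i; lia.
  - by move=> z; apply: internal_pair_dvdn hadj neq_li dvd_kl.
  - by apply: ord_shared; case: (a).
case: heps => -> //; rewrite -(pair_divisorN (shared k a)).
exact: is_orderN.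
Qed.
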